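(* The limit model, when $\varepsilon\searrow0$, of the problem $$\partial_t f^\varepsilon+\frac1\varepsilon\bar v\cdot\nabla_{\bar x}f^\varepsilon+v_3\partial_{x_3}f^\varepsilon+\frac qm E\cdot\nabla_v f^\varepsilon+\frac{\omega_c}{\varepsilon}\,{}^\perp\bar v\cdot\nabla_{\bar v}f^\varepsilon=Q_{FP}(f^\varepsilon),\qquad f^\varepsilon(0,\cdot,\cdot)=f^{\rm in},$$ with $Q_{FP}(f)=\frac{\theta}{m\tau}\,\mathrm{div}_v\{M\nabla_v(f/M)\}$, is given by $$\partial_t f+\frac{\langle{}^\perp\bar E\rangle}{B}\cdot\nabla_{\bar x}f+v_3\partial_{x_3}f+\frac qm\langle E_3\rangle\partial_{v_3}f=\langle Q_{FP}\rangle f,\quad (t,x,v)\in\mathbb R_+\times\mathbb R^3\times\mathbb R^3,\qquad f(0,x,v)=\langle f^{\rm in}\rangle(x,v),$$ where $$\langle Q_{FP}\rangle f(x,v)=\frac{\theta}{m\tau}\,\mathrm{div}_{\omega_c x,v}\Big\{M\,\mathcal L\,\nabla_{\omega_c x,v}\Big(\frac fM\Big)\Big\},\qquad \mathcal L=\begin{pmatrix}2(I_3-e_3\otimes e_3)&-\mathcal E\\ \mathcal E&I_3\end{pmatrix},\qquad \mathcal E=\begin{pmatrix}0&1&0\\-1&0&0\\0&0&0\end{pmatrix}.$$ That is, every smooth solution $f$ of the limit model (in the formal sense recalled in the context) satisfies these equations.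
   Context: Notation. $x=(x_1,x_2,x_3)$, $v=(v_1,v_2,v_3)\in\mathbb R^3$, $\bar x=(x_1,x_2)$, $\bar v=(v_1,v_2)$, $e_3=(0,0,1)$; for $w=(w_1,w_2)$, ${}^\perp w=(w_2,-w_1)$. Constants: $m>0$, $q\neq0$, $B>0$, $\omega_c=qB/m$, $\tau>0$, $\theta>0$. $M(v)=(2\pi\theta/m)^{-3/2}e^{-m|v|^2/(2\theta)}$. The electric field $E=E(x)=-\nabla_x\phi$ derives from a given smooth potential; $\bar E=(E_1,E_2)$. $\nabla_{\omega_c x,v}u=(\frac1{\omega_c}\nabla_x u,\nabla_v u)\in\mathbb R^6$ and $\mathrm{div}_{\omega_c x,v}(\xi_x,\xi_v)=\frac1{\omega_c}\mathrm{div}_x\xi_x+\mathrm{div}_v\xi_v$. Transport operator: $\mathcal Tu=\bar v\cdot\nabla_{\bar x}u+\omega_c{}^\perp\bar v\cdot\nabla_{\bar v}u$. Average operator: $$\langle u\rangle(x,v)=\frac1{2\pi}\int_0^{2\pi}u\Big(\bar x+\frac{{}^\perp\bar v}{\omega_c}-\frac{{}^\perp\{|\bar v|e^{i\alpha}\}}{\omega_c},x_3,|\bar v|e^{i\alpha},v_3\Big)d\alpha,\quad e^{i\alpha}=(\cos\alpha,\sin\alpha),$$ applied componentwise to vector-valued functions; functions of $x$ only are regarded as functions of $(x,v)$. Limit model (formal sense). For a collision kernel $Q$, inserting $f^\varepsilon=f+\varepsilon f^1+\varepsilon^2f^2+\dots$ in the equation gives at the two leading orders $\mathcal Tf=0$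 and $\partial_t f+v_3\partial_{x_3}f+\frac qmE\cdot\nabla_vf+\mathcal Tf^1=Q(f)$ for some $f^1$. Eliminating $f^1$ by averaging, the limit model for $f$ is: $\mathcal Tf(t)=0$ for all $t$, $\langle\partial_tf+v_3\partial_{x_3}f+\frac qmE\cdot\nabla_vf\rangle=\langle Q(f)\rangle$, with initial datum $f(0)=\langle f^{\rm in}\rangle$. *)

(* Defs.v *)
From HB Require Import structures.
From mathcomp Require Import all_boot all_order all_algebra.
From mathcomp Require Import all_classical all_reals all_analysis.

Set Implicit Arguments.
Unset Strict Implicit.
Unset Printing Implicit Defensive.

Import Order.TTheory GRing.Theory Num.Theory.
Import numFieldNormedType.Exports.

Local Open Scope classical_set_scope.
Local Open Scope ring_scope.

(* Points, velocities and fields are column vectors, so that matrices such as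
   L below act on the left.  The library's norm on matrices is the sup norm:
   Euclidean lengths are always written through [dot]. *)

Definition dot (R : realType) n (u w : 'cV[R]_n) : R := (u^T *m w) 0 0.

Definition bar (R : realType) (x : 'cV[R]_3) : 'cV[R]_2 :=
  usubmx (x : 'cV[R]_(2 + 1)).

Definition third (R : realType) (x : 'cV[R]_3) : R := x ord_max 0.

Definition vec3 (R : realType) (w : 'cV[R]_2) (z : R) : 'cV[R]_3 :=
  col_mx w (z%:M : 'cV[R]_1) : 'cV[R]_(2 + 1).

Definition perp (R : realType) (w : 'cV[R]_2) : 'cV[R]_2 :=
  \col_(i < 2) (if i == 0 then w 1 0 else - w 0 0).

Definition cis (R : realType) (a : R) : 'cV[R]_2 :=
  \col_(i < 2) (if i == 0 then cos a else sin a).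

Definition e3 (R : realType) : 'cV[R]_3 := delta_mx ord_max 0.

(* C^k and C^oo on a finite-dimensional space: f is C^(k+1) iff it is
   differentiable with all its directional derivatives of class C^k. *)
Fixpoint classC (R : realType) (V : normedModType R) (k : nat) (f : V -> R)
    : Prop :=
  match k with
  | 0 => continuous f
  | k'.+1 => (forall a, differentiable f a) /\
             (forall w, classC k' (fun a => 'D_w f a))
  end.

Definition smooth (R : realType) (V : normedModType R) (f : V -> R) : Prop :=
  forall k, classC k f.

(* Smoothness on R_+ x R^3 x R^3, up to the boundary t = 0: restriction of a
   smooth function on R x R^3 x R^3.  Values of f at t < 0 play no role. *)
Definition smooth_in_time (R : realType)
    (f : R -> 'cV[R]_3 -> 'cV[R]_3 -> R) : Prop :=
  exists F : R * 'cV[R]_3 * 'cV[R]_3 -> R,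
    smooth F /\ forall (t : R) (x v : 'cV[R]_3), 0 <= t -> f t x v = F (t, x, v).

(* Time derivative of a function on R_+: one-sided at t = 0. *)
Definition dt (R : realType) (f : R -> 'cV[R]_3 -> 'cV[R]_3 -> R)
    (t : R) (x v : 'cV[R]_3) : R :=
  lim ((fun h : R => h^-1 * (f (t + h) x v - f t x v))
         @ within [set h : R | 0 <= t + h] 0^').

Definition grad (R : realType) n (g : 'cV[R]_n.+1 -> R) (x : 'cV[R]_n.+1)
    : 'cV[R]_n.+1 :=
  \col_i 'D_(delta_mx i 0) g x.

Definition div (R : realType) n (F : 'cV[R]_n.+1 -> 'cV[R]_n.+1)
    (x : 'cV[R]_n.+1) : R :=
  \sum_i 'D_(delta_mx i 0) (fun y => F y i 0) x.

Definition grad_x (R : realType) (u : 'cV[R]_3 -> 'cV[R]_3 -> R)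
    (x v : 'cV[R]_3) : 'cV[R]_3 := grad (fun y => u y v) x.

Definition grad_v (R : realType) (u : 'cV[R]_3 -> 'cV[R]_3 -> R)
    (x v : 'cV[R]_3) : 'cV[R]_3 := grad (fun w => u x w) v.

Definition grad_wxv (R : realType) (wc : R) (u : 'cV[R]_3 -> 'cV[R]_3 -> R)
    (x v : 'cV[R]_3) : 'cV[R]_(3 + 3) :=
  col_mx (wc^-1 *: grad_x u x v) (grad_v u x v).

Definition div_wxv (R : realType) (wc : R)
    (xi : 'cV[R]_3 -> 'cV[R]_3 -> 'cV[R]_(3 + 3)) (x v : 'cV[R]_3) : R :=
  wc^-1 * div (fun y => usubmx (xi y v)) x + div (fun w => dsubmx (xi x w)) v.

Definition transport (R : realType) (wc : R)
    (u : 'cV[R]_3 -> 'cV[R]_3 -> R) (x v : 'cV[R]_3) : R :=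
  dot (bar v) (bar (grad_x u x v)) + wc * dot (perp (bar v)) (bar (grad_v u x v)).

Definition average (R : realType) (wc : R)
    (u : 'cV[R]_3 -> 'cV[R]_3 -> R) (x v : 'cV[R]_3) : R :=
  let w (a : R) := Num.sqrt (dot (bar v) (bar v)) *: cis a in
  (2 * pi)^-1 *
  (\int[lebesgue_measure]_(a in `[0, 2 * pi])
     u (vec3 (bar x + wc^-1 *: perp (bar v) - wc^-1 *: perp (w a)) (third x))
       (vec3 (w a) (third v)))%R.

Definition average_vec (R : realType) n (wc : R)
    (u : 'cV[R]_3 -> 'cV[R]_3 -> 'cV[R]_n) (x v : 'cV[R]_3) : 'cV[R]_n :=
  \col_i average wc (fun y w => u y w i 0) x v.

Definition maxwellian (R : realType) (m theta : R) (v : 'cV[R]_3) : R :=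
  (2 * pi * theta / m) `^ (- (3 / 2)) * expR (- (m * dot v v / (2 * theta))).

Definition electric_field (R : realType) (phi : 'cV[R]_3 -> R)
    (x : 'cV[R]_3) : 'cV[R]_3 := - grad phi x.

Definition Q_FP (R : realType) (m tau theta : R)
    (f : 'cV[R]_3 -> 'cV[R]_3 -> R) (x v : 'cV[R]_3) : R :=
  theta / (m * tau) *
  div (fun w => maxwellian m theta w *:
         grad_v (fun y w' => f y w' / maxwellian m theta w') x w) v.

(* Limit model for a collision kernel Q: the order -1 and the averaged order 0
   equations of the expansion f + eps f1 + ... in
     d_t f + (1/eps) T f + v3 d_x3 f + (q/m) E . grad_v f = Q f ;
   the corrector f1 enters the order 0 equation only through T f1, which
   averages to zero. *)
Definition limit_model (R : realType) (m q wc : R)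
    (E : 'cV[R]_3 -> 'cV[R]_3)
    (Q : ('cV[R]_3 -> 'cV[R]_3 -> R) -> 'cV[R]_3 -> 'cV[R]_3 -> R)
    (fin : 'cV[R]_3 -> 'cV[R]_3 -> R)
    (f : R -> 'cV[R]_3 -> 'cV[R]_3 -> R) : Prop :=
  [/\ forall (t : R) (x v : 'cV[R]_3), 0 <= t -> transport wc (f t) x v = 0,
      forall (t : R) (x v : 'cV[R]_3), 0 <= t ->
        average wc (fun y w => dt f t y w + third w * third (grad_x (f t) y w)
                               + q / m * dot (E y) (grad_v (f t) y w)) x v
        = average wc (Q (f t)) x v
    & forall x v, f 0 x v = average wc fin x v].

Definition curlE (R : realType) : 'M[R]_3 := delta_mx 0 1 - delta_mx 1 0.

Definition calL (R : realType) : 'M[R]_(3 + 3) :=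
  block_mx (2 *: (1%:M - e3 R *m (e3 R)^T)) (- curlE R)
           (curlE R)                        1%:M.

Definition averaged_Q_FP (R : realType) (m tau theta wc : R)
    (f : 'cV[R]_3 -> 'cV[R]_3 -> R) (x v : 'cV[R]_3) : R :=
  theta / (m * tau) *
  div_wxv wc (fun y w => maxwellian m theta w *:
    (calL R *m grad_wxv wc (fun y' w' => f y' w' / maxwellian m theta w') y w))
    x v.

(* Main.v *)
Require Import Defs.
From mathcomp Require Import all_boot all_order all_algebra.
From mathcomp Require Import all_classical all_reals all_analysis.
From mathcomp Require Import ring.

Set Implicit Arguments.
Unset Strict Implicit.
Unset Printing Implicit Defensive.

Import Order.TTheory GRing.Theory Num.Theory.
Import numFieldNormedType.Exports.
Local Open Scope classical_set_scope.
Local Open Scope ring_scope.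

(** The fast dynamics turns the planar velocity and keeps the centre of
    gyration.  Turning by the angle b is the linear map [gyrate b] of phase
    space, and [average] is the mean of a function along the circle of all
    [gyrate b (x, v)], with the angle measured from that of the planar velocity
    of v ([average_circle_mean]).  The condition T f = 0 says that the derivative
    of f along these circles vanishes, so f is invariant under every [gyrate b]
    ([transport0_invariant]).  As [gyrate b] is linear, invariance passes to
    derivatives: the derivative of f at [gyrate b p] in a direction r is the
    derivative of f at p in the direction [gyrate (- b) r], and likewise at second
    order ([derive_gyrate], [derive2_gyrate]).  Thus each term of the equation,
    evaluated along the circle through p, is a trigonometric polynomial in b,
    with coefficients made of derivatives of f at p and, in the force term, of
    the values of E along the circle; averaging only concerns these scalars.

    - The terms d_t f and v_3 d_x3 f are constant along the circle.

    - In E . grad_v f, a v-derivative splits into a derivative that moves the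
      centre of gyration and one, in a direction [centred_dir z], that keeps it.
      The former gives perp E / wc . grad_x f.  At fixed centre f depends on the
      planar velocity through its length only, so that the latter is a multiple
      of the power E . v ([centred_gradient_radial]).  This multiple is the same
      along the whole circle, and E . v is there, up to a constant factor, the
      derivative of the potential phi, a periodic function: its mean is zero
      ([circle_mean_potential_work]).

    - Writing W_i for the derivative in the direction [centred_dir] of the i-th
      basis vector, div_v (M grad_v (f / M)) at [gyrate b p] equals
      sum_i W_i W_i f + (d_x1 d_x1 + d_x2 d_x2) f / wc ^ 2 plus lower-order
      terms, plus multiples of cos b and sin b ([Q_FP_gyrate]): the terms of
      degree two in cos b, sin b combine by cos ^ 2 + sin ^ 2 = 1, because the
      operator sum_i W_i W_i is invariant under rotation.  This constant part is
      exactly the divergence form with the matrix L ([averaged_Q_FPE]), and the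
      means of cos and sin vanish. *)

(** * Means over one period *)

Section CircleMean.
Variable R : realType.
Implicit Types (h k : R -> R) (a b c : R).

Definition circle_mean h : R :=
  (2 * pi)^-1 * (\int[lebesgue_measure]_(a in `[0, 2 * pi]) h a)%R.

Let twopi_gt0 : 0 < 2 * pi :> R.
Proof. by rewrite mulr_gt0 ?pi_gt0. Qed.

Lemma continuous_integrable_period h : continuous h ->
  lebesgue_measure.-integrable `[0, 2 * pi] (EFin \o h).
Proof.
move=> h_cont; apply: continuous_compact_integrable; first exact: segment_compact.
exact: continuous_subspaceT.
Qed.

Lemma circle_mean_cst c : circle_mean (fun=> c) = c.
Proof.
rewrite /circle_mean Rintegral_cst//= lebesgue_measure_itv/= lte_fin twopi_gt0.
by rewrite oppr0 addr0 mulrCA mulVf ?mulr1// gt_eqF.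
Qed.

Lemma circle_meanD h k : continuous h -> continuous k ->
  circle_mean (fun a => h a + k a) = circle_mean h + circle_mean k.
Proof.
move=> h_cont k_cont; rewrite /circle_mean RintegralD//; first exact: mulrDr.
- exact: continuous_integrable_period.
- exact: continuous_integrable_period.
Qed.

Lemma circle_meanZ c h : continuous h ->
  circle_mean (fun a => c * h a) = c * circle_mean h.
Proof.
move=> h_cont; rewrite /circle_mean RintegralZl//; first exact: mulrCA.
exact: continuous_integrable_period.
Qed.

Lemma continuous_translate b h : continuous h -> continuous (fun a => h (a - b)).
Proof.
move=> h_cont a; apply: (@continuous_comp _ _ _ (fun a : R => a - b) h).
  by apply: continuousB => //; exact: cst_continuous.
exact: h_cont.
Qed.

Lemma continuous_mulcst c h : continuous h -> continuous (fun a => c * h a).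
Proof. by move=> h_cont a; apply: cvgM; [exact: cvg_cst|exact: h_cont]. Qed.

Lemma continuous_sum2 h k : continuous h -> continuous k ->
  continuous (fun a => h a + k a).
Proof. by move=> h_cont k_cont a; apply: cvgD; [exact: h_cont|exact: k_cont]. Qed.

(** The primitive k takes the same value at both ends of the period.  The
    translation by b is the initial phase of an orbit. *)
Lemma circle_mean_derivative (k h : R -> R) b :
  (forall a, is_derive a 1 k (h a)) -> continuous h -> periodic k (pi *+ 2) ->
  circle_mean (fun a => h (a - b)) = 0.
Proof.
move=> dk h_cont k_per; pose kb a := k (a - b).
have dkb a : is_derive a 1 kb (h (a - b)).
  rewrite -[h _]mulr1 -[1 in X in is_derive _ _ _ X]addr0 -[0 in X in is_derive _ _ _ X]oppr0.
  exact: (@is_derive1_comp _ k (fun a => a - b)).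
have kb_cont : continuous kb.
  by move=> a; apply/differentiable_continuous/derivable1_diffP; case: (dkb a).
have hb_cont := continuous_translate (b := b) h_cont.
have := continuous_FTC2 (F := kb) twopi_gt0 (continuous_subspaceT hb_cont).
rewrite /circle_mean /Rintegral => ->.
- have k_endpoints : kb (2 * pi) = kb 0.
    by rewrite /kb add0r addrC mulr_natl k_per.
  by rewrite -EFinB /= k_endpoints subrr mulr0.
- split; first by move=> a _; case: (dkb a).
  + exact: cvg_at_right_filter (kb_cont _).
  + exact: cvg_at_left_filter (kb_cont _).
- by move=> a _; rewrite derive1E; case: (dkb a).
Qed.

Lemma circle_mean_cos b : circle_mean (fun a => cos (a - b)) = 0.
Proof.
by apply: (circle_mean_derivative (k := sin)); [exact: continuous_cos|exact: sinD2pi].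
Qed.

Lemma circle_mean_sin b : circle_mean (fun a => sin (a - b)) = 0.
Proof.
apply: (circle_mean_derivative (k := fun a => - cos a)); last 2 first.
- exact: continuous_sin.
- by move=> a; rewrite cosD2pi.
by move=> a; rewrite -[sin a]opprK; exact: is_deriveN.
Qed.

End CircleMean.

(** * Directional derivatives *)

Section DirectionalDerivatives.
Variables (R : realType) (V W : normedModType R).
Implicit Types (p w : V) (g : W -> R) (a : R).

(** The difference quotients of both sides agree before any limit is taken. *)
Lemma derive_comp_linear (L : V -> W) g p w : linear L ->
  'D_w (g \o L) p = 'D_(L w) g (L p).
Proof.
move=> L_lin; rewrite /derive.
by under eq_fun do rewrite /= L_lin.
Qed.

Lemma is_derive_comp_curve (c : R -> W) g a (dc : W) :
  is_derive a (1 : R) c dc -> differentiable g (c a) ->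
  is_derive a (1 : R) (g \o c) ('D_dc g (c a)).
Proof.
move=> [c_der <-] dg.
have dc_a : differentiable c a by exact/derivable1_diffP.
apply: DeriveDef; first exact/derivable1_diffP/differentiable_comp.
have dgc : differentiable (g \o c) a by exact: differentiable_comp.
by rewrite (deriveE _ dgc) (diff_comp dc_a dg) (deriveE _ dg) (deriveE _ dc_a).
Qed.

Lemma derive_linear_direction (f : V -> R) p a w w' : differentiable f p ->
  'D_(a *: w + w') f p = a * 'D_w f p + 'D_w' f p.
Proof. by move=> df; rewrite !deriveE// linearP. Qed.

Lemma derive_scale_direction (f : V -> R) p a w : differentiable f p ->
  'D_(a *: w) f p = a * 'D_w f p.
Proof. by move=> df; rewrite !deriveE// linearZ. Qed.

Lemma continuous_curve (c : R -> W) (dc : R -> W) :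
  (forall a, is_derive a (1 : R) c (dc a)) -> continuous c.
Proof.
move=> dcP a; apply/differentiable_continuous/derivable1_diffP.
by case: (dcP a).
Qed.

End DirectionalDerivatives.

Section CircleCurves.
Variables (R : realType) (V : normedModType R).

Lemma is_derive_scalel (k : R -> R) (dk a : R) (w : V) :
  is_derive a (1 : R) k dk -> is_derive a (1 : R) (fun b => k b *: w) (dk *: w).
Proof.
move=> [k_der <-]; have dk_a : differentiable k a by exact/derivable1_diffP.
apply: DeriveDef; first exact/derivable1_diffP/differentiableZl.
have dkw : differentiable (fun b => k b *: w) a by exact: differentiableZl.
by rewrite (deriveE _ dkw) (diffZl w dk_a) (deriveE _ dk_a).
Qed.

Lemma is_derive_circle (p u w : V) (a : R) :
  is_derive a (1 : R) (fun b => p + cos b *: u + sin b *: w)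
    (- sin a *: u + cos a *: w).
Proof.
rewrite -[- sin a *: u]add0r.
apply: is_deriveD; last exact: is_derive_scalel.
by apply: is_deriveD; exact: is_derive_scalel.
Qed.

End CircleCurves.

Section ScalarChain.
Variables (R : realType) (V : normedModType R).

Lemma is_derive_comp_scalar (h : R -> R) (g : V -> R) (p w : V) (dh dg : R) :
  differentiable g p -> is_derive p w g dg -> is_derive (g p) (1 : R) h dh ->
  is_derive p w (h \o g) (dh * dg).
Proof.
move=> dgp [_ <-] [h_der <-].
have dhp : differentiable h (g p) by exact/derivable1_diffP.
have dhg : differentiable (h \o g) p by exact: differentiable_comp.
apply: DeriveDef; first exact: diff_derivable.
rewrite (deriveE _ dhg) (diff_comp dgp dhp) (deriveE _ dgp) (deriveE _ dhp) /=.
by rewrite -[X in 'd h _ X]mulr1 -[_ * 1]/(_ *: 1) linearZ mulrC.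
Qed.

End ScalarChain.

Section Bilinear.
Variables (R : realType) (V : normedModType R) (U : V -> R).
Hypothesis dU : forall p, differentiable U p.
Hypothesis d2U : forall p w, differentiable ('D_w U) p.
Implicit Types (p q r : V) (a b c : R).

Lemma derive2_linearr p q r r' a :
  'D_q ('D_(a *: r + r') U) p = a * 'D_q ('D_r U) p + 'D_q ('D_r' U) p.
Proof.
have -> : 'D_(a *: r + r') U = a \*: 'D_r U + 'D_r' U.
  by apply/funext => s; rewrite derive_linear_direction.
rewrite deriveD; last 2 first.
- exact/derivableZ/diff_derivable.
- exact/diff_derivable.
by rewrite deriveZ//; exact: diff_derivable.
Qed.

Lemma derive2_linearl p q q' r a :
  'D_(a *: q + q') ('D_r U) p = a * 'D_q ('D_r U) p + 'D_q' ('D_r U) p.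
Proof. exact: derive_linear_direction. Qed.

End Bilinear.

Section PhaseSpace.
Variable R : realType.
Local Notation vec := ('cV[R]_3).
Local Notation phase := (vec * vec)%type.
Implicit Types (x v w y : vec) (p : phase) (U : phase -> R).

Lemma derive_sliceL U x v w : 'D_w (fun y => U (y, v)) x = 'D_(w, 0) U (x, v).
Proof.
have slice_line h : (h *: w + x, v) = h *: (w, 0) + (x, v) :> phase.
  by congr pair; rewrite /= scaler0 add0r.
by rewrite /derive; under [in RHS]eq_fun do rewrite /= -slice_line.
Qed.

Lemma derive_sliceR U x v w : 'D_w (fun y => U (x, y)) v = 'D_(0, w) U (x, v).
Proof.
have slice_line h : (x, h *: w + v) = h *: (0, w) + (x, v) :> phase.
  by congr pair; rewrite /= scaler0 add0r.
by rewrite /derive; under [in RHS]eq_fun do rewrite /= -slice_line.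
Qed.

End PhaseSpace.

(** * Coordinates in three-space *)

Section Coordinates.
Variable R : realType.
Local Notation vec := ('cV[R]_3).
Local Notation E := (curlE R).
Implicit Types v w : vec.

Lemma ord3_cases (P : 'I_3 -> Prop) : P 0 -> P 1 -> P ord_max -> forall i, P i.
Proof.
move=> P0 P1 P2 [[|[|[|//]]] lt_i3].
- by rewrite (_ : Ordinal _ = 0)//; exact: val_inj.
- by rewrite (_ : Ordinal _ = 1)//; exact: val_inj.
- by rewrite (_ : Ordinal _ = ord_max)//; exact: val_inj.
Qed.

Lemma vec_ext v w :
  v 0 0 = w 0 0 -> v 1 0 = w 1 0 -> v ord_max 0 = w ord_max 0 -> v = w.
Proof.
by move=> vw0 vw1 vw2; apply/colP; apply: ord3_cases.
Qed.

Lemma sum3 (F : 'I_3 -> R) : \sum_i F i = F 0 + F 1 + F ord_max.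
Proof.
rewrite !big_ord_recl big_ord0 addr0 addrA.
by congr (_ + F _ + F _); exact: val_inj.
Qed.

Lemma dot3 v w :
  dot v w = v 0 0 * w 0 0 + v 1 0 * w 1 0 + v ord_max 0 * w ord_max 0.
Proof. by rewrite /dot mxE sum3 !mxE. Qed.

Lemma dot2 (v w : 'cV[R]_2) : dot v w = v 0 0 * w 0 0 + v 1 0 * w 1 0.
Proof.
rewrite /dot mxE !big_ord_recl big_ord0 addr0 !mxE.
by congr (_ + v _ _ * w _ _); exact: val_inj.
Qed.

Lemma bar_coord v : (bar v 0 0 = v 0 0) * (bar v 1 0 = v 1 0).
Proof. by split; rewrite /bar mxE; congr (v _ _); exact: val_inj. Qed.

Lemma perp_coord (w : 'cV[R]_2) :
  (perp w 0 0 = w 1 0) * (perp w 1 0 = - w 0 0).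
Proof. by split; rewrite mxE. Qed.

Lemma vec3_coord (u : 'cV[R]_2) z :
  (vec3 u z 0 0 = u 0 0) * (vec3 u z 1 0 = u 1 0) * (vec3 u z ord_max 0 = z).
Proof.
have i0 : (0 : 'I_3) = lshift 1 (0 : 'I_2) by exact: val_inj.
have i1 : (1 : 'I_3) = lshift 1 (1 : 'I_2) by exact: val_inj.
have i2 : (ord_max : 'I_3) = rshift 2 (0 : 'I_1) by exact: val_inj.
split; first split.
- by rewrite i0; exact: (@col_mxEu R 2 1 1).
- by rewrite i1; exact: (@col_mxEu R 2 1 1).
- by rewrite i2; apply: etrans (@col_mxEd R 2 1 1 _ _ _ _) _; rewrite mxE.
Qed.

Lemma curlE_coord v : ((E *m v) 0 0 = v 1 0) * ((E *m v) 1 0 = - v 0 0) *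
  ((E *m v) ord_max 0 = 0).
Proof.
by do 2?split; rewrite mxE sum3 !mxE/=; ring.
Qed.

End Coordinates.

(** * The gyration *)

Section Gyration.
Variables (R : realType) (wc : R).
Local Notation vec := ('cV[R]_3).
Local Notation phase := (vec * vec)%type.
Local Notation E := (curlE R).
Implicit Types (x v w y : vec) (p q : phase) (a b : R).

(** Since curlE is the generator of the planar rotations, up to sign, and
    satisfies E ^ 3 = - E, Rodrigues' formula gives the rotation by the angle b
    around the magnetic axis without leaving the three-dimensional vectors. *)
Definition rotation b v : vec := v - sin b *: (E *m v) + (1 - cos b) *: (E *m (E *m v)).

Lemma rotation_coord b v :
  (rotation b v 0 0 = cos b * v 0 0 - sin b * v 1 0) *
  (rotation b v 1 0 = sin b * v 0 0 + cos b * v 1 0) *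
  (rotation b v ord_max 0 = v ord_max 0).
Proof.
by do 2?split; rewrite !(curlE_coord, mxE); ring.
Qed.

(** The vector E v / wc is that from the position to the centre of gyration, so
    the centre x + E v / wc is left fixed. *)
Definition gyrate b p : phase :=
  (p.1 + wc^-1 *: (E *m (p.2 - rotation b p.2)), rotation b p.2).

Lemma gyrate_is_linear b : linear (gyrate b).
Proof.
move=> k p q.
have rot_lin v w : rotation b (k *: v + w) = k *: rotation b v + rotation b w.
  by apply: vec_ext; rewrite !(rotation_coord, mxE); ring.
rewrite /gyrate /= rot_lin; congr pair.
by apply: vec_ext; rewrite !(rotation_coord, curlE_coord, mxE); ring.
Qed.

Lemma gyrateK b : cancel (gyrate (- b)) (gyrate b).
Proof.
move=> [x v]; rewrite /gyrate /=.
have rotK : rotation b (rotation (- b) v) = v.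
  have cs := cos2Dsin2 b.
  apply: vec_ext; rewrite !rotation_coord ?cosN ?sinN.
  - by rewrite -[RHS]mul1r -cs; ring.
  - by rewrite -[RHS]mul1r -cs; ring.
  - by [].
by rewrite rotK; congr pair; apply: vec_ext; rewrite !(curlE_coord, mxE); ring.
Qed.

Lemma gyrate0 p : gyrate 0 p = p.
Proof.
case: p => x v; rewrite /gyrate/=.
have -> : rotation 0 v = v by apply: vec_ext; rewrite !rotation_coord ?cos0 ?sin0; ring.
by rewrite subrr mulmx0 scaler0 addr0.
Qed.

(** The arc cosine yields the angle in the upper half plane; its opposite serves
    the lower one. *)
Lemma polar (v : 'cV[R]_2) : exists b, v = Num.sqrt (dot v v) *: cis b.
Proof.
have dotE : dot v v = v 0 0 ^+ 2 + v 1 0 ^+ 2 by rewrite dot2 !expr2.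
have [dot0|dot_neq0] := eqVneq (dot v v) 0.
  exists 0; rewrite dot0 sqrtr0 scale0r.
  move: dot0 => /eqP; rewrite dotE paddr_eq0 ?sqr_ge0// !sqrf_eq0 => /andP[/eqP v0 /eqP v1].
  apply/colP => i; rewrite !mxE; case: i => [[|[|//]] lt_i].
  - by rewrite (_ : Ordinal _ = 0)//; exact: val_inj.
  - by rewrite (_ : Ordinal _ = 1)//; exact: val_inj.
have dot_gt0 : 0 < dot v v by rewrite lt_neqAle eq_sym dot_neq0 dotE addr_ge0 ?sqr_ge0.
pose r := Num.sqrt (dot v v).
have r_gt0 : 0 < r by rewrite sqrtr_gt0.
have r_neq0 : r != 0 by rewrite gt_eqF.
pose c := v 0 0 / r; pose s := v 1 0 / r.
have cs1 : c ^+ 2 + s ^+ 2 = 1.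
  rewrite /c /s !expr_div_n -mulrDl -dotE sqr_sqrtr ?divff//; exact: ltW.
have c_bound : -1 <= c <= 1.
  by rewrite -ler_norml -(@expr_le1 _ 2)// real_normK ?num_real// -cs1 lerDl sqr_ge0.
have sinc : `|s| = sin (acos c).
  by rewrite sin_acos// -cs1 addrC addKr sqrtr_sqr.
have [b [cosb sinb]] : exists b, cos b = c /\ sin b = s.
  have acosc : cos (acos c) = c by rewrite acosK// in_itv/=.
  have [s_ge0|s_lt0] := leP 0 s.
  - by exists (acos c); split=> //; rewrite -sinc ger0_norm.
  - by exists (- acos c); rewrite cosN sinN -sinc ltr0_norm ?opprK.
exists b; apply/colP => i; rewrite !mxE -/r cosb sinb /c /s.
case: i => [[|[|//]] lt_i] /=; rewrite mulrCA divff// mulr1.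
- by congr (v _ _); exact: val_inj.
- by congr (v _ _); exact: val_inj.
Qed.

(** The angle a of the definition of [average] is absolute, whereas [gyrate]
    measures it from the angle b of the planar velocity; b is chosen once, before
    u, so that several averages at one point share it. *)
Lemma average_circle_mean x v : exists b, forall u : vec -> vec -> R,
  average wc u x v =
  circle_mean (fun a => u (gyrate (a - b) (x, v)).1 (gyrate (a - b) (x, v)).2).
Proof.
have [b vb] := polar (bar v); exists b => u.
rewrite /average /circle_mean; congr (_ * _); apply: eq_Rintegral => a _.
have rotE : vec3 (Num.sqrt (dot (bar v) (bar v)) *: cis a) (third v) = rotation (a - b) v.
  have v0 := congr1 (fun w : 'cV_2 => w 0 0) vb.
  have v1 := congr1 (fun w : 'cV_2 => w 1 0) vb.
  have cs := cos2Dsin2 b.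
  move: v0 v1; rewrite !bar_coord !mxE/= => v0 v1.
  apply: vec_ext; rewrite !(vec3_coord, rotation_coord) ?mxE//= {}v0 {}v1 cosB sinB.
  - by rewrite -[LHS]mulr1 -cs; ring.
  - by rewrite -[LHS]mulr1 -cs; ring.
rewrite rotE /gyrate/=; congr u.
have orbit_bar : bar (rotation (a - b) v) = Num.sqrt (dot (bar v) (bar v)) *: cis a.
  by rewrite -rotE /bar /vec3 col_mxKu.
rewrite -orbit_bar.
by apply: vec_ext; rewrite !(vec3_coord, curlE_coord, perp_coord, bar_coord, mxE);
  rewrite /third; ring.
Qed.

End Gyration.

(** * Functions constant along the gyration *)

Section Invariance.
Variables (R : realType) (wc : R).
Local Notation vec := ('cV[R]_3).
Local Notation phase := (vec * vec)%type.
Local Notation E := (curlE R).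
Implicit Types (x v w y z : vec) (p q : phase) (a b : R).

(** Displacements of phase space that change the velocity by z and keep the
    centre of gyration x + E v / wc fixed. *)
Definition centred_dir z : phase := (- wc^-1 *: (E *m z), z).

Lemma centred_dir_is_linear : linear centred_dir.
Proof.
move=> k z w; rewrite /centred_dir; congr pair.
by apply: vec_ext; rewrite !(curlE_coord, mxE); ring.
Qed.

Lemma gyrateE b x v : gyrate wc b (x, v) =
  (x + wc^-1 *: (E *m v), v + E *m (E *m v))
  + cos b *: centred_dir (- (E *m (E *m v))) + sin b *: centred_dir (- (E *m v)).
Proof.
by congr pair; apply: vec_ext; rewrite /= !(rotation_coord, curlE_coord, mxE); ring.
Qed.

(** Orbits keep their centre, and their velocity turns at unit speed. *)
Lemma is_derive_gyrate p b :
  is_derive b (1 : R) (gyrate wc ^~ p) (centred_dir (- (E *m (gyrate wc b p).2))).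
Proof.
case: p => x v.
have -> : centred_dir (- (E *m (gyrate wc b (x, v)).2)) =
    - sin b *: centred_dir (- (E *m (E *m v))) + cos b *: centred_dir (- (E *m v)).
  by congr pair; apply: vec_ext; rewrite /= !(rotation_coord, curlE_coord, mxE); ring.
rewrite (_ : gyrate wc ^~ (x, v) = fun b => (x + wc^-1 *: (E *m v), v + E *m (E *m v))
  + cos b *: centred_dir (- (E *m (E *m v))) + sin b *: centred_dir (- (E *m v))).
  exact: is_derive_circle.
by apply/funext => c; exact: gyrateE.
Qed.

Lemma derive_grad (g : vec -> R) x w : differentiable g x ->
  'D_w g x = dot w (grad g x).
Proof.
move=> dg; rewrite dot3 !mxE.
have {1}-> : w = w 0 0 *: delta_mx 0 0 + (w 1 0 *: delta_mx 1 0
    + w ord_max 0 *: delta_mx ord_max 0).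
  by apply: vec_ext; rewrite !mxE/=; ring.
by rewrite !deriveE// !linearD !linearZ/= addrA.
Qed.

Section Slices.
Variable U : phase -> R.
Hypothesis dU : forall p, differentiable U p.
Local Notation u := (fun x v => U (x, v)).

Lemma differentiable_sliceL x v : differentiable (u ^~ v) x.
Proof.
apply: (differentiable_comp (f := fun y => (y, v))); last exact: dU.
exact: differentiable_pair.
Qed.

Lemma differentiable_sliceR x v : differentiable (u x) v.
Proof.
apply: (differentiable_comp (f := fun y => (x, y))); last exact: dU.
exact: differentiable_pair.
Qed.

Lemma derive_phase x v y w :
  'D_(y, w) U (x, v) = dot y (grad_x u x v) + dot w (grad_v u x v).
Proof.
rewrite /grad_x /grad_v -derive_grad; last exact: differentiable_sliceL.
rewrite -derive_grad; last exact: differentiable_sliceR.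
rewrite derive_sliceL derive_sliceR !deriveE// -linearD; congr ('d _ _ _).
by congr pair; rewrite /= ?addr0 ?add0r.
Qed.

(** Along T the angle of the planar velocity grows at the rate - wc. *)
Lemma transportE x v : wc != 0 ->
  transport wc u x v = - wc * 'D_(centred_dir (- (E *m v))) U (x, v).
Proof.
move=> wc_neq0; rewrite derive_phase /transport !dot2 !dot3.
move: (grad_x _ _ _) (grad_v _ _ _) => gx gv.
rewrite !(perp_coord, bar_coord) !(curlE_coord, mxE).
by field.
Qed.

Hypothesis wc_neq0 : wc != 0.
Hypothesis TU0 : forall x v, transport wc u x v = 0.

Lemma transport0_orbit_dir x v : 'D_(centred_dir (- (E *m v))) U (x, v) = 0.
Proof.
have wcN_neq0 : - wc != 0 by rewrite oppr_eq0.
by apply: (mulfI wcN_neq0); rewrite -transportE// TU0 mulr0.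
Qed.

Lemma transport0_invariant b p : U (gyrate wc b p) = U p.
Proof.
rewrite -[in RHS](gyrate0 wc p).
apply: (is_derive_0_is_cst (f := U \o (gyrate wc ^~ p))) => a.
have -> : 0 = 'D_(centred_dir (- (E *m (gyrate wc a p).2))) U (gyrate wc a p).
  by rewrite [X in 'D__ U X]surjective_pairing transport0_orbit_dir.
exact/is_derive_comp_curve/dU/is_derive_gyrate.
Qed.

(** Invariance composed with [derive_comp_linear], the map [gyrate (- b)] being
    the inverse of [gyrate b]. *)
Lemma derive_gyrate b p q :
  'D_q U (gyrate wc b p) = 'D_(gyrate wc (- b) q) U p.
Proof.
have U_inv : U \o gyrate wc b = U by apply/funext => r; exact: transport0_invariant.
by rewrite -[in RHS]U_inv (derive_comp_linear _ _ _ (gyrate_is_linear wc b)) gyrateK.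
Qed.

Lemma derive2_gyrate b p q r :
  'D_q ('D_r U) (gyrate wc b p)
  = 'D_(gyrate wc (- b) q) ('D_(gyrate wc (- b) r) U) p.
Proof.
have <- : 'D_r U \o gyrate wc b = 'D_(gyrate wc (- b) r) U.
  by apply/funext => s; exact: derive_gyrate.
by rewrite (derive_comp_linear _ _ _ (gyrate_is_linear wc b)) gyrateK.
Qed.

End Slices.
End Invariance.

(** * The electric force along an orbit *)

Section ElectricField.
Variables (R : realType) (wc : R).
Hypothesis wc_neq0 : wc != 0.
Local Notation vec := ('cV[R]_3).
Local Notation phase := (vec * vec)%type.
Local Notation E := (curlE R).
Implicit Types (x v w y z e : vec) (p q : phase) (a b : R).

(** Half a turn fixes the points of zero planar velocity and reverses the planar
    centred directions; hence the planar centred derivatives of an invariant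
    function vanish at such points. *)
Lemma gyrate_pi x v : v 0 0 = 0 -> v 1 0 = 0 -> gyrate wc pi (x, v) = (x, v).
Proof.
move=> v0 v1; congr pair; apply: vec_ext;
  by rewrite /= !(rotation_coord, curlE_coord, mxE) ?cospi ?sinpi ?v0 ?v1; ring.
Qed.

Lemma gyrateN_pi_centred_dir z : z ord_max 0 = 0 ->
  gyrate wc (- pi) (centred_dir wc z) = - centred_dir wc z.
Proof.
move=> z2; congr pair; apply: vec_ext;
  by rewrite /= !(rotation_coord, curlE_coord, mxE) ?cosN ?sinN ?cospi ?sinpi ?z2; ring.
Qed.

(** At fixed centre of gyration U is a radial function of the planar velocity, so
    its gradient is parallel to v.  Away from the axis this follows from the
    vanishing of the derivative along the orbit, and on the axis, where that
    condition is void, from the invariance under half a turn. *)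
Lemma centred_gradient_radial (U : phase -> R) x v :
  (forall p, differentiable U p) ->
  (forall x v, transport wc (fun x v => U (x, v)) x v = 0) ->
  exists l : R, forall z, z ord_max 0 = 0 ->
    'D_(centred_dir wc z) U (x, v) = l * dot v z.
Proof.
move=> dU TU0.
pose W i := 'D_(centred_dir wc (delta_mx i 0)) U (x, v).
have WE z : z ord_max 0 = 0 ->
    'D_(centred_dir wc z) U (x, v) = z 0 0 * W 0 + z 1 0 * W 1.
  move=> z2.
  have {1}-> : centred_dir wc z =
      z 0 0 *: centred_dir wc (delta_mx 0 0) + z 1 0 *: centred_dir wc (delta_mx 1 0).
    by congr pair; apply: vec_ext; rewrite /= !(curlE_coord, mxE) ?z2/=; ring.
  rewrite derive_linear_direction//; congr (_ + _).
  exact: derive_scale_direction.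
suff [l [Wl0 Wl1]] : exists l, W 0 = l * v 0 0 /\ W 1 = l * v 1 0.
  by exists l => z z2; rewrite WE// dot3 z2 Wl0 Wl1; ring.
have TW : v 0 0 * W 1 = v 1 0 * W 0.
  have := transport0_orbit_dir dU wc_neq0 TU0 x v.
  rewrite WE; last by rewrite !(curlE_coord, mxE) oppr0.
  by rewrite !(curlE_coord, mxE) opprK addrC mulNr => /subr0_eq.
have [v0|v0] := eqVneq (v 0 0) 0; last first.
  exists (W 0 / v 0 0); split; first by rewrite divfK.
  by apply: (mulfI v0); rewrite TW; field.
have [v1|v1] := eqVneq (v 1 0) 0; last first.
  exists (W 1 / v 1 0); split; last by rewrite divfK.
  by apply: (mulfI v1); rewrite -TW v0; ring.
have W0 z : z ord_max 0 = 0 -> 'D_(centred_dir wc z) U (x, v) = 0.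
  move=> z2; apply/eqP; rewrite -[_ == 0](mulrn_eq0 _ 2) mulr2n addr_eq0.
  rewrite -{1}(gyrate_pi x v0 v1) derive_gyrate// gyrateN_pi_centred_dir//.
  by rewrite (deriveE _ (dU _)) linearN -(deriveE _ (dU _)).
by exists 0; rewrite !mul0r; split; apply: W0; rewrite mxE.
Qed.

(** The pulled back direction [gyrate (- b) (0, e)] is the sum of a displacement
    of the centre, with the velocity component along the magnetic axis, and of the
    centred direction of the planar part z of the rotated e.  The latter
    contributes a multiple of v . z, which is the planar product of e with the
    velocity on the orbit; only this last term depends on b. *)
Lemma derive_v_gyrate (U : phase -> R) x v :
  (forall p, differentiable U p) ->
  (forall x v, transport wc (fun x v => U (x, v)) x v = 0) ->
  let u := fun x v => U (x, v) in
  exists l : R, forall b e,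
    'D_(0, e) U (gyrate wc b (x, v)) =
      wc^-1 * (e 1 0 * grad_x u x v 0 0 - e 0 0 * grad_x u x v 1 0)
      + e ord_max 0 * grad_v u x v ord_max 0
      + l * (rotation b v 0 0 * e 0 0 + rotation b v 1 0 * e 1 0).
Proof.
move=> dU TU0 u; have [l lP] := centred_gradient_radial x v dU TU0.
exists l => b e; rewrite derive_gyrate//.
pose z := - (E *m (E *m rotation (- b) e)).
have -> : gyrate wc (- b) (0, e) =
    1 *: (wc^-1 *: (E *m e), e + E *m (E *m e)) + centred_dir wc z.
  rewrite scale1r; congr pair; apply: vec_ext;
    by rewrite /= !(rotation_coord, curlE_coord, mxE) ?cosN ?sinN; ring.
rewrite derive_linear_direction// lP; last first.
  by rewrite !(curlE_coord, mxE) oppr0.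
rewrite mul1r derive_phase//; congr (_ + _ * _).
  rewrite !dot3 -/u; move: (grad_x _ _ _) (grad_v _ _ _) => gx gv.
  by rewrite !(curlE_coord, mxE); ring.
by rewrite dot3 !(rotation_coord, curlE_coord, mxE) cosN sinN; ring.
Qed.

Lemma gyrate_periodic p : periodic (gyrate wc ^~ p) (pi *+ 2).
Proof.
by move=> b; rewrite /gyrate /rotation cosD2pi sinD2pi.
Qed.

Lemma continuous_gyrate p : continuous (gyrate wc ^~ p).
Proof. by apply: continuous_curve => b; exact: is_derive_gyrate. Qed.

Lemma continuous_gyrate_x p : continuous (fun b => (gyrate wc b p).1).
Proof.
move=> a; apply: (@continuous_comp _ _ _ (gyrate wc ^~ p) fst).
  exact: continuous_gyrate.
exact: cvg_fst.
Qed.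

Lemma continuous_along_orbit (g : vec -> R) p :
  continuous g -> continuous (fun a => g (gyrate wc a p).1).
Proof.
move=> g_cont a.
apply: (@continuous_comp _ _ _ (fun a => (gyrate wc a p).1) g); last exact: g_cont.
exact: continuous_gyrate_x.
Qed.

Lemma continuous_rotation v i : continuous (fun b => rotation b v i 0).
Proof.
move=> a; apply: (@continuous_comp _ _ _ (fun b : R => rotation b v) (fun w : vec => w i 0)).
  apply: (@continuous_comp _ _ _ (gyrate wc ^~ (0, v)) snd).
    exact: continuous_gyrate.
  exact: cvg_snd.
exact: coord_continuous.
Qed.

(** As the angle grows, positions on the orbit move in the plane by - v / wc, so this
    work is wc times the derivative of the potential. *)
Lemma circle_mean_potential_work (phi : vec -> R) x v b :
  (forall y, differentiable phi y) ->
  (forall i, continuous (fun y => electric_field phi y i 0)) ->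
  circle_mean (fun a =>
    rotation (a - b) v 0 0 * electric_field phi (gyrate wc (a - b) (x, v)).1 0 0 +
    rotation (a - b) v 1 0 * electric_field phi (gyrate wc (a - b) (x, v)).1 1 0) = 0.
Proof.
move=> dphi E_cont; pose k a := wc * phi (gyrate wc a (x, v)).1.
pose h a := rotation a v 0 0 * electric_field phi (gyrate wc a (x, v)).1 0 0 +
    rotation a v 1 0 * electric_field phi (gyrate wc a (x, v)).1 1 0.
apply: (circle_mean_derivative (h := h) (k := k)).
- move=> a; rewrite /k.
  have dphi1 p : differentiable (phi \o fst) p.
    by apply: differentiable_comp => //; apply: linear_differentiable => q; exact: cvg_fst.
  have := is_derive_comp_curve (is_derive_gyrate wc (x, v) a) (dphi1 _).
  rewrite derive_comp_linear// derive_grad// => /(is_deriveZ wc).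
  rewrite dot3 /h !(rotation_coord, curlE_coord, mxE)/=.
  by move=> d; apply: (is_derive_eq d); rewrite /GRing.scale/=; field.
- have Ex_cont i : continuous (fun a => electric_field phi (gyrate wc a (x, v)).1 i 0).
    exact: (continuous_along_orbit (g := fun y => electric_field phi y i 0)).
  by move=> a; rewrite /h; apply: cvgD; apply: cvgM;
    [exact: continuous_rotation|exact: Ex_cont|exact: continuous_rotation|exact: Ex_cont].
- by move=> a; rewrite /k gyrate_periodic.
Qed.

End ElectricField.

(** * The two Fokker-Planck operators in non-divergence form *)

Section FokkerPlanck.
Variables (R : realType) (m theta tau wc : R).
Hypotheses (m_gt0 : 0 < m) (theta_gt0 : 0 < theta).
Local Notation vec := ('cV[R]_3).
Local Notation phase := (vec * vec)%type.
Local Notation M := (maxwellian m theta).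
Implicit Types (x v w y z e : vec) (p q r : phase) (a b : R).

Lemma is_derive_coord v w i : is_derive v w (fun y : vec => y i 0) (w i 0).
Proof.
have d : differentiable (fun y : vec => y i 0) v by exact: differentiable_coord.
apply: DeriveDef; first exact: diff_derivable.
have := @derive_mx _ _ _ _ (@id vec) v w.
rewrite derive_id => /(_ (@derivable_id _ _ _ _)) => /matrixP/(_ i 0).
by rewrite mxE.
Qed.

Lemma maxwellian_gt0 v : 0 < M v.
Proof.
rewrite /maxwellian mulr_gt0 ?expR_gt0// powR_gt0//.
by rewrite !mulr_gt0 ?invr_gt0 ?pi_gt0.
Qed.

Lemma maxwellian_neq0 v : M v != 0.
Proof. by rewrite gt_eqF// maxwellian_gt0. Qed.

(** The inverse of the Maxwellian appears rather than the Maxwellian because the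
    operators differentiate the quotient f / M. *)
Lemma is_derive_maxwellianV v w :
  is_derive v w (fun y => (M y)^-1) (m / theta * dot v w / M v).
Proof.
pose k := m / (2 * theta).
pose energy y := k * (y 0 0 * y 0 0 + y 1 0 * y 1 0 + y ord_max 0 * y ord_max 0).
pose C := ((2 * pi * theta / m) `^ (- (3 / 2)))^-1.
have ME : (fun y => (M y)^-1) = (fun s : R => C * expR s) \o energy.
  apply/funext => y; rewrite /= /maxwellian invfM -expRN opprK; congr (_ * expR _).
  by rewrite /energy /k dot3; field; rewrite gt_eqF.
have dcoord y i : differentiable (fun y : vec => y i 0 * y i 0) y.
  by apply: differentiableM; exact: differentiable_coord.
have denergy y : differentiable energy y.
  by apply: differentiableZ; do 2?apply: differentiableD.
have Dcoord i : is_derive v w (fun y : vec => y i 0 * y i 0) (2 * v i 0 * w i 0).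
  have d := is_deriveM (is_derive_coord v w i) (is_derive_coord v w i).
  by apply: (is_derive_eq d); rewrite /GRing.scale/=; ring.
have Denergy : is_derive v w energy (m / theta * dot v w).
  have := is_deriveZ k (is_deriveD (is_deriveD (Dcoord 0) (Dcoord 1)) (Dcoord ord_max)).
  by move=> d; apply: (is_derive_eq d); rewrite /GRing.scale/= /k dot3; field; rewrite gt_eqF.
have Dexp : is_derive (energy v) (1 : R) (fun s : R => C * expR s) (C * expR (energy v)).
  exact: is_deriveZ.
have -> : m / theta * dot v w / M v = C * expR (energy v) * (m / theta * dot v w).
  by rewrite mulrC; congr (_ * _); exact: (congr1 (@^~ v) ME).
by rewrite ME; exact: is_derive_comp_scalar.
Qed.

Section Fluxes.
Variable U : phase -> R.
Hypothesis dU : forall p, differentiable U p.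
Hypothesis d2U : forall p q, differentiable ('D_q U) p.
Local Notation u := (fun x v => U (x, v)).
Local Notation h := (fun x v => U (x, v) / M v).
Local Notation dirx i := (delta_mx i 0 : vec, 0 : vec).
Local Notation dirv i := (0 : vec, delta_mx i 0 : vec).

Lemma maxwellian_grad_x x v i : M v * grad_x h x v i 0 = 'D_(dirx i) U (x, v).
Proof.
rewrite /grad_x mxE.
have -> : (fun y => h y v) = (M v)^-1 \*: (fun y => U (y, v)).
  by apply/funext => y; rewrite /= [RHS]/(_ *: _) /= mulrC.
rewrite deriveZ; last exact/diff_derivable/(differentiable_sliceL dU).
by rewrite derive_sliceL /GRing.scale/= mulrA divff ?mul1r// maxwellian_neq0.
Qed.

Lemma maxwellian_grad_v x v i :
  M v * grad_v h x v i 0 = 'D_(dirv i) U (x, v) + m / theta * v i 0 * U (x, v).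
Proof.
rewrite /grad_v mxE.
have dotV : dot v (delta_mx i 0) = v i 0.
  by rewrite dot3 !mxE; elim/ord3_cases: i; rewrite /=; ring.
have DV := is_derive_maxwellianV v (delta_mx i 0).
have -> : (fun y => h x y) = (fun y => U (x, y)) * (fun y => (M y)^-1) by [].
rewrite deriveM; last 2 first.
- exact/diff_derivable/(differentiable_sliceR dU).
- by case: DV.
case: DV => _ ->; rewrite derive_sliceR dotV /GRing.scale/=.
by field; rewrite maxwellian_neq0 gt_eqF.
Qed.

(** The non-zero components of the fluxes of both operators have this shape, a
    derivative of U and a drift term. *)
Lemma derive_flux p q r k i :
  'D_q (fun p => 'D_r U p + k * (p.2 i 0 * U p)) p =
  'D_q ('D_r U) p + k * (q.2 i 0 * U p + p.2 i 0 * 'D_q U p).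
Proof.
have dcoord : differentiable (fun p : phase => p.2 i 0) p.
  apply: (@differentiable_comp _ _ _ _ snd (fun y : vec => y i 0)).
    by apply: linear_differentiable => ?; exact: cvg_snd.
  exact: differentiable_coord.
have Dcoord : 'D_q (fun p : phase => p.2 i 0) p = q.2 i 0.
  apply: etrans (derive_comp_linear (L := snd) (fun y : vec => y i 0) p q _) _ => //.
  by case: (is_derive_coord p.2 q.2 i).
have -> : (fun p => 'D_r U p + k * (p.2 i 0 * U p)) =
    'D_r U + k \*: ((fun p : phase => p.2 i 0) * U) by [].
rewrite deriveD; last 2 first.
- exact: diff_derivable.
- by apply/derivableZ/derivableM; exact: diff_derivable.
rewrite deriveZ; last by apply/derivableM; exact: diff_derivable.
rewrite deriveM; try exact: diff_derivable.
by rewrite Dcoord /GRing.scale/=; ring.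
Qed.

Lemma derive_linear_image (L : vec -> phase) p w : linear L ->
  'D_(L w) U p = \sum_i w i 0 * 'D_(L (delta_mx i 0)) U p.
Proof.
move=> L_lin; have L0 : L 0 = 0.
  by have /eqP := L_lin 1 0 0; rewrite !scale1r addr0 -subr_eq0 opprD addNKr oppr_eq0 => /eqP.
have {1}-> : w = w 0 0 *: delta_mx 0 0 + (w 1 0 *: delta_mx 1 0
    + (w ord_max 0 *: delta_mx ord_max 0 + 0)).
  by apply: vec_ext; rewrite !mxE/=; ring.
pose D q := 'D_q U p.
have D_lin k q r : D (k *: q + r) = k * D q + D r by exact: derive_linear_direction.
have D0 : D 0 = 0 by exact: derive0.
rewrite !L_lin L0 -/(D _); under eq_bigr do rewrite -/(D _).
by move: D D_lin D0 => D D_lin D0; rewrite !D_lin D0 sum3; ring.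
Qed.

Lemma derive_centred_dir p :
  ('D_(centred_dir wc (delta_mx 0 0)) U p = wc^-1 * 'D_(dirx 1) U p + 'D_(dirv 0) U p) *
  ('D_(centred_dir wc (delta_mx 1 0)) U p = - wc^-1 * 'D_(dirx 0) U p + 'D_(dirv 1) U p) *
  ('D_(centred_dir wc (delta_mx ord_max 0)) U p = 'D_(dirv ord_max) U p).
Proof.
split; first split.
- rewrite -(derive_linear_direction _ _ _ (dU p)); congr ('D_(_) U p).
  by congr pair; apply: vec_ext; rewrite !(curlE_coord, mxE)/=; ring.
- rewrite -(derive_linear_direction _ _ _ (dU p)); congr ('D_(_) U p).
  by congr pair; apply: vec_ext; rewrite !(curlE_coord, mxE)/=; ring.
- congr ('D_(_) U p).
  by congr pair; apply: vec_ext; rewrite !(curlE_coord, mxE)/=; ring.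
Qed.

Lemma Q_FPE x v : Q_FP m tau theta u x v = theta / (m * tau) *
  (\sum_i 'D_(dirv i) ('D_(dirv i) U) (x, v)
   + m / theta * (3 * U (x, v) + 'D_(0, v) U (x, v))).
Proof.
rewrite /Q_FP /div; congr (_ * _).
have flux i : 'D_(delta_mx i 0) (fun w => (M w *: grad_v h x w) i 0) v =
    'D_(dirv i) ('D_(dirv i) U) (x, v)
    + m / theta * (U (x, v) + v i 0 * 'D_(dirv i) U (x, v)).
  have -> : (fun w => (M w *: grad_v h x w) i 0) =
      (fun w => 'D_(dirv i) U (x, w) + m / theta * (w i 0 * U (x, w))).
    by apply/funext => w; rewrite mxE maxwellian_grad_v mulrA.
  rewrite (derive_sliceR (fun p => 'D_(dirv i) U p + m / theta * (p.2 i 0 * U p))).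
  by rewrite derive_flux/= mxE !eqxx mul1r.
rewrite (eq_bigr _ (fun i _ => flux i)).
rewrite (@derive_linear_image (fun w => (0, w))); last first.
  by move=> k w w'; congr pair; rewrite /= scaler0 addr0.
rewrite !sum3.
move: ('D_(dirv 0) ('D_(dirv 0) U) (x, v)) ('D_(dirv 0) U (x, v)) => A0 B0.
move: ('D_(dirv 1) ('D_(dirv 1) U) (x, v)) ('D_(dirv 1) U (x, v)) => A1 B1.
move: ('D_(dirv ord_max) ('D_(dirv ord_max) U) (x, v)) ('D_(dirv ord_max) U (x, v)) => A2 B2.
by ring.
Qed.

End Fluxes.
End FokkerPlanck.

Section AveragedFokkerPlanck.
Variables (R : realType) (m theta tau wc : R).
Hypotheses (m_gt0 : 0 < m) (theta_gt0 : 0 < theta).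
Local Notation vec := ('cV[R]_3).
Local Notation phase := (vec * vec)%type.
Local Notation E := (curlE R).
Local Notation M := (maxwellian m theta).
Implicit Types (x v w y z e : vec) (p q r : phase) (a b : R).
Variable U : phase -> R.
Hypothesis dU : forall p, differentiable U p.
Hypothesis d2U : forall p q, differentiable ('D_q U) p.
Local Notation u := (fun x v => U (x, v)).
Local Notation h := (fun x v => U (x, v) / M v).
Local Notation dirx i := (delta_mx i 0 : vec, 0 : vec).
Local Notation dirv i := (0 : vec, delta_mx i 0 : vec).
Local Notation dirc i := (centred_dir wc (delta_mx i 0)).

Lemma calL_mul (gx gv : vec) :
  calL R *m col_mx gx gv =
  col_mx (2 *: (gx - e3 R *m ((e3 R)^T *m gx)) - E *m gv) (E *m gx + gv).
Proof.
rewrite /calL mul_block_col mul1mx mulNmx -scalemxAl mulmxBl mul1mx.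
by rewrite mulmxA.
Qed.

Lemma e3_proj_coord (g : vec) :
  ((e3 R *m ((e3 R)^T *m g)) 0 0 = 0) * ((e3 R *m ((e3 R)^T *m g)) 1 0 = 0) *
  ((e3 R *m ((e3 R)^T *m g)) ord_max 0 = g ord_max 0).
Proof.
by do 2?split; rewrite mxE big_ord1 !mxE sum3 !mxE/=; ring.
Qed.

(** The directions are combinations in which at most one coefficient differs from
    1, the form in which linearity of the derivative is stated. *)
Lemma averaged_flux_x x v :
  let J i := usubmx (M v *: (calL R *m grad_wxv wc h x v) : 'cV_(3 + 3)) i 0 in
  [/\ J 0 = 'D_(-2 *: dirc 1 + dirv 1) U (x, v) + - (m / theta) * (v 1 0 * U (x, v)),
      J 1 = 'D_(wc^-1 *: dirx 1 + dirc 0) U (x, v) + m / theta * (v 0 0 * U (x, v))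
    & J ord_max = 0].
Proof.
have gx j := maxwellian_grad_x m_gt0 theta_gt0 dU x v j.
have gv j := maxwellian_grad_v m_gt0 theta_gt0 dU x v j.
have scale_coord k (g : vec) j : (k *: g) j 0 = k * g j 0 by rewrite mxE.
have sub_coord (g g' : vec) j : (g - g') j 0 = g j 0 - g' j 0 by rewrite !mxE.
rewrite /= !(derive_linear_direction _ _ _ (dU _)) !derive_centred_dir//.
rewrite calL_mul scale_col_mx col_mxKu; split.
- rewrite scale_coord sub_coord scale_coord sub_coord curlE_coord e3_proj_coord scale_coord.
  by rewrite mulrBr gv subr0 !(mulrCA (M v)) gx; ring.
- rewrite scale_coord sub_coord scale_coord sub_coord curlE_coord e3_proj_coord scale_coord.
  by rewrite opprK mulrDr gv subr0 !(mulrCA (M v)) gx; ring.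
- rewrite scale_coord sub_coord scale_coord sub_coord curlE_coord e3_proj_coord.
  by rewrite subrr mulr0 subr0 mulr0.
Qed.

(** The lower rows of the matrix L turn the v-derivative into the derivative at
    fixed centre of gyration. *)
Lemma averaged_flux_v x v i :
  dsubmx (M v *: (calL R *m grad_wxv wc h x v) : 'cV_(3 + 3)) i 0 =
  'D_(dirc i) U (x, v) + m / theta * (v i 0 * U (x, v)).
Proof.
have gx j := maxwellian_grad_x m_gt0 theta_gt0 dU x v j.
have gv j := maxwellian_grad_v m_gt0 theta_gt0 dU x v j.
have scale_coord k (g : vec) j : (k *: g) j 0 = k * g j 0 by rewrite mxE.
rewrite calL_mul scale_col_mx col_mxKd scale_coord [X in _ * X]mxE mulrDr gv.
move: i; apply: ord3_cases; rewrite derive_centred_dir// curlE_coord ?scale_coord.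
- by rewrite mulrCA gx; ring.
- by rewrite mulrN mulrCA gx; ring.
- by ring.
Qed.

(** The x-flux contains the centred derivatives along basis vectors 1 and 0 with
    the signs of E; together with the v-divergence of the centred flux they
    complete the operator to a sum of squares of centred derivatives, and what is
    left of the x-flux is a planar Laplacian. *)
Lemma averaged_Q_FPE x v : averaged_Q_FP m tau theta wc u x v =
  theta / (m * tau) *
  (\sum_i 'D_(dirc i) ('D_(dirc i) U) (x, v)
   + wc^-1 ^+ 2 * ('D_(dirx 0) ('D_(dirx 0) U) (x, v) + 'D_(dirx 1) ('D_(dirx 1) U) (x, v))
   + m / theta * (3 * U (x, v) + 'D_(centred_dir wc v) U (x, v))).
Proof.
rewrite /averaged_Q_FP /div_wxv; congr (_ * _).
pose A i := 'D_(dirx i) ('D_(dirx i) U) (x, v).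
pose B i j := 'D_(dirx i) ('D_(dirc j) U) (x, v).
pose C i := 'D_(dirv i) ('D_(dirc i) U) (x, v).
pose Gx i := 'D_(dirx i) U (x, v); pose Gv i := 'D_(dirv i) U (x, v).
have flux_v i : 'D_(delta_mx i 0) (fun w =>
      dsubmx (M w *: (calL R *m grad_wxv wc h x w) : 'cV_(3 + 3)) i 0) v =
    C i + m / theta * (U (x, v) + v i 0 * Gv i).
  under eq_fun do rewrite averaged_flux_v.
  rewrite (derive_sliceR (fun p => 'D_(dirc i) U p + m / theta * (p.2 i 0 * U p))).
  by rewrite derive_flux//= mxE !eqxx mul1r.
have flux_x0 : 'D_(delta_mx 0 0) (fun y =>
      usubmx (M v *: (calL R *m grad_wxv wc h y v) : 'cV_(3 + 3)) 0 0) x =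
    wc^-1 * A 0 - B 0 1 - m / theta * (v 1 0 * Gx 0).
  under eq_fun do rewrite (let: And3 e _ _ := averaged_flux_x _ v in e).
  rewrite (derive_sliceL (fun p => 'D_(-2 *: dirc 1 + dirv 1) U p
    + - (m / theta) * (p.2 1 0 * U p))).
  pose b := 'D_(dirx 0) ('D_(dirv 1) U) (x, v).
  have flux_dir : 'D_(dirx 0) ('D_(-2 *: dirc 1 + dirv 1) U) (x, v) = -2 * B 0 1 + b.
    exact: derive2_linearr.
  have BE : B 0 1 = - wc^-1 * A 0 + b.
    have dirc1E : dirc 1 = - wc^-1 *: dirx 0 + dirv 1.
      by congr pair; apply: vec_ext; rewrite /= !(curlE_coord, mxE)/=; ring.
    by rewrite /B dirc1E; exact: derive2_linearr.
  rewrite derive_flux//= flux_dir mxE mul0r add0r -/(Gx 0).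
  by clear flux_dir; move: A B b Gx BE => A B b Gx ->; ring.
have flux_x1 : 'D_(delta_mx 1 0) (fun y =>
      usubmx (M v *: (calL R *m grad_wxv wc h y v) : 'cV_(3 + 3)) 1 0) x =
    wc^-1 * A 1 + B 1 0 + m / theta * (v 0 0 * Gx 1).
  under eq_fun do rewrite (let: And3 _ e _ := averaged_flux_x _ v in e).
  rewrite (derive_sliceL (fun p => 'D_(wc^-1 *: dirx 1 + dirc 0) U p
    + m / theta * (p.2 0 0 * U p))).
  have flux_dir : 'D_(dirx 1) ('D_(wc^-1 *: dirx 1 + dirc 0) U) (x, v) =
      wc^-1 * A 1 + B 1 0 by exact: derive2_linearr.
  by rewrite derive_flux//= flux_dir mxE mul0r add0r.
have flux_x2 : 'D_(delta_mx ord_max 0) (fun y =>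
      usubmx (M v *: (calL R *m grad_wxv wc h y v) : 'cV_(3 + 3)) ord_max 0) x = 0.
  under eq_fun do rewrite (let: And3 _ _ e := averaged_flux_x _ v in e).
  exact: derive_cst.
have sumW : \sum_i 'D_(dirc i) ('D_(dirc i) U) (x, v) =
    (wc^-1 * B 1 0 + C 0) + (- wc^-1 * B 0 1 + C 1) + C ord_max.
  have split_dirc i := derive_centred_dir wc (d2U ^~ (dirc i)) (x, v).
  have add3 (a b c a' b' c' : R) : a = a' -> b = b' -> c = c' -> a + b + c = a' + b' + c'.
    by move=> -> -> ->.
  rewrite sum3.
  exact (add3 _ _ _ _ _ _ (split_dirc 0).1.1 (split_dirc 1).1.2 (split_dirc ord_max).2).
have dirv_part : 'D_(centred_dir wc v) U (x, v) =
    v 0 0 * (wc^-1 * Gx 1 + Gv 0) + v 1 0 * (- wc^-1 * Gx 0 + Gv 1)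
    + v ord_max 0 * Gv ord_max.
  rewrite (derive_linear_image dU _ _ (@centred_dir_is_linear _ wc)) sum3.
  by have [[-> ->] ->] := derive_centred_dir wc dU (x, v).
rewrite /div (eq_bigr _ (fun i _ => flux_v i)) [X in wc^-1 * X]sum3 flux_x0 flux_x1 flux_x2.
rewrite sumW dirv_part -[X in _ ^+ 2 * X]/(A 0 + A 1) sum3.
clear flux_v flux_x0 flux_x1 flux_x2 sumW dirv_part.
by move: A B C Gx Gv => A B C Gx Gv; ring.
Qed.

End AveragedFokkerPlanck.

(** * The Fokker-Planck operator along an orbit *)

Lemma bilinear_quadratic (R : realType) (V : lmodType R) (T : V -> V -> R)
    (q0 q1 q2 : V) (a b c : R) :
  (forall k q q' r, T (k *: q + q') r = k * T q r + T q' r) ->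
  (forall k q r r', T q (k *: r + r') = k * T q r + T q r') ->
  let q := a *: q0 + (b *: q1 + c *: q2) in
  T q q = a ^+ 2 * T q0 q0 + b ^+ 2 * T q1 q1 + c ^+ 2 * T q2 q2
    + a * b * (T q0 q1 + T q1 q0) + a * c * (T q0 q2 + T q2 q0)
    + b * c * (T q1 q2 + T q2 q1).
Proof.
move=> TDl TDr /=.
have TZl k q r : T (k *: q) r = k * T q r.
  have T0 : T 0 r = 0.
    by have /eqP := TDl 1 0 0 r; rewrite scale1r addr0 mul1r -subr_eq0 opprD addNKr oppr_eq0 => /eqP.
  by rewrite -[k *: q]addr0 TDl T0 addr0.
have TZr k q r : T q (k *: r) = k * T q r.
  have T0 : T q 0 = 0.
    by have /eqP := TDr 1 q 0 0; rewrite scale1r addr0 mul1r -subr_eq0 opprD addNKr oppr_eq0 => /eqP.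
  by rewrite -[k *: r]addr0 TDr T0 addr0.
by rewrite !TDl !TZl !TDr !TZr; ring.
Qed.

Section FokkerPlanckAlongOrbits.
Variables (R : realType) (m theta tau wc : R).
Hypotheses (m_gt0 : 0 < m) (theta_gt0 : 0 < theta) (wc_neq0 : wc != 0).
Local Notation vec := ('cV[R]_3).
Local Notation phase := (vec * vec)%type.
Local Notation E := (curlE R).
Variable U : phase -> R.
Hypothesis dU : forall p, differentiable U p.
Hypothesis d2U : forall p q, differentiable ('D_q U) p.
Local Notation u := (fun x v => U (x, v)).
Hypothesis TU0 : forall x v, transport wc u x v = 0.
Local Notation dirx i := (delta_mx i 0 : vec, 0 : vec).
Local Notation dirv i := (0 : vec, delta_mx i 0 : vec).
Local Notation dirc i := (centred_dir wc (delta_mx i 0)).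

Lemma gyrate_dirv b :
  [/\ gyrate wc (- b) (dirv 0) =
        - wc^-1 *: dirx 1 + (cos b *: dirc 0 + (- sin b) *: dirc 1),
      gyrate wc (- b) (dirv 1) =
        wc^-1 *: dirx 0 + (cos b *: dirc 1 + sin b *: dirc 0)
    & gyrate wc (- b) (dirv ord_max) = dirc ord_max].
Proof.
by split; congr pair; apply: vec_ext;
  rewrite /= !(rotation_coord, curlE_coord, mxE) /= ?cosN ?sinN; ring.
Qed.

Lemma gyrate_velocity b (v : vec) :
  gyrate wc (- b) (0, rotation b v) =
  cos b *: (wc^-1 *: (E *m v), 0)
  + (sin b *: (- wc^-1 *: (E *m (E *m v)), 0) + centred_dir wc v).
Proof.
have cs := cos2Dsin2 b.
have rotationK : rotation (- b) (rotation b v) = v.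
  apply: vec_ext; rewrite !rotation_coord ?cosN ?sinN; last by [].
  - by rewrite -[RHS]mul1r -cs; ring.
  - by rewrite -[RHS]mul1r -cs; ring.
rewrite /gyrate /= rotationK; congr pair; apply: vec_ext;
  by rewrite /= !(rotation_coord, curlE_coord, mxE); ring.
Qed.

(** The values of k and l are read off from the expansion of the quadratic form
    along the three pulled back basis vectors; they collect the cross terms that
    are of degree one in cos b and sin b. *)
Lemma Q_FP_gyrate (x v : vec) : exists k l : R, forall b,
  Q_FP m tau theta u (gyrate wc b (x, v)).1 (gyrate wc b (x, v)).2 =
  averaged_Q_FP m tau theta wc u x v + cos b * k + sin b * l.
Proof.
(* T and D stay abstract: from here on only their linearity is used. *)
have [T TE] : exists T : phase -> phase -> R,
    T = (fun q r => 'D_q ('D_r U) (x, v)) by eexists.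
have [D DE] : exists D : phase -> R, D = (fun q => 'D_q U (x, v)) by eexists.
have TDl a q q' r : T (a *: q + q') r = a * T q r + T q' r.
  by rewrite TE; exact: derive2_linearl.
have TDr a q r r' : T q (a *: r + r') = a * T q r + T q r'.
  by rewrite TE; exact: derive2_linearr.
have D_lin a q r : D (a *: q + r) = a * D q + D r.
  by rewrite DE; exact: derive_linear_direction.
have avgE : averaged_Q_FP m tau theta wc u x v = theta / (m * tau) *
    (\sum_i T (dirc i) (dirc i)
     + wc^-1 ^+ 2 * (T (dirx 0) (dirx 0) + T (dirx 1) (dirx 1))
     + m / theta * (3 * U (x, v) + D (centred_dir wc v))).
  by rewrite averaged_Q_FPE// TE DE.
have QE b : Q_FP m tau theta u (gyrate wc b (x, v)).1 (gyrate wc b (x, v)).2 =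
    theta / (m * tau) *
    (\sum_i T (gyrate wc (- b) (dirv i)) (gyrate wc (- b) (dirv i))
     + m / theta * (3 * U (x, v) + D (gyrate wc (- b) (0, rotation b v)))).
  have sumE : \sum_i 'D_(dirv i) ('D_(dirv i) U) (gyrate wc b (x, v)) =
      \sum_i T (gyrate wc (- b) (dirv i)) (gyrate wc (- b) (dirv i)).
    by apply: eq_bigr => i _; rewrite TE; exact (derive2_gyrate dU wc_neq0 TU0 b _ _ _).
  have velE : 'D_(0, rotation b v) U (gyrate wc b (x, v)) =
      D (gyrate wc (- b) (0, rotation b v)).
    by rewrite DE; exact (derive_gyrate dU wc_neq0 TU0 b _ _).
  rewrite Q_FPE// -surjective_pairing sumE (transport0_invariant dU wc_neq0 TU0).
  by rewrite velE.
pose s i j := T (dirx i) (dirc j) + T (dirc j) (dirx i).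
exists (theta / (m * tau) * (wc^-1 * (s 0 1 - s 1 0)
  + m / theta * D (wc^-1 *: (E *m v), 0))).
exists (theta / (m * tau) * (wc^-1 * (s 1 1 + s 0 0)
  + m / theta * D (- wc^-1 *: (E *m (E *m v)), 0))) => b.
have [g0 g1 g2] := gyrate_dirv b.
rewrite {}QE {}avgE gyrate_velocity !D_lin !sum3 {}g0 {}g1 {}g2 /s.
rewrite !(bilinear_quadratic _ _ _ _ _ _ TDl TDr).
move: (D _) (D _) (D _) => D0 D1 D2.
have cs := cos2Dsin2 b.
(* The terms in cos b * sin b of the two planar directions cancel. *)
rewrite !sqrrN; have -> : sin b ^+ 2 = 1 - cos b ^+ 2 by rewrite -cs; ring.
move: (dirx 0) (dirx 1) (dirc 0) (dirc 1) (dirc ord_max) => X0 X1 W0 W1 W2.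
by clear s TE; ring.
Qed.

End FokkerPlanckAlongOrbits.

(** * Averages of the terms of the limit model *)

Section AverageAlongOrbits.
Variables (R : realType) (wc : R).
Hypothesis wc_neq0 : wc != 0.
Local Notation vec := ('cV[R]_3).
Local Notation phase := (vec * vec)%type.
Variable U : phase -> R.
Hypothesis dU : forall p, differentiable U p.
Local Notation u := (fun x v => U (x, v)).
Hypothesis TU0 : forall x v, transport wc u x v = 0.

Lemma average_Q_FP (m tau theta : R) (x v : vec) : 0 < m -> 0 < theta ->
  (forall p q, differentiable ('D_q U) p) ->
  average wc (Q_FP m tau theta u) x v = averaged_Q_FP m tau theta wc u x v.
Proof.
move=> m_gt0 theta_gt0 d2U; have [c ->] := average_circle_mean wc x v.
have [k [l]] := Q_FP_gyrate tau m_gt0 theta_gt0 wc_neq0 dU d2U TU0 x v.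
move: (averaged_Q_FP _ _ _ _ _ _ _) => A QE.
under [X in circle_mean X]eq_fun do rewrite QE mulrC [_ * l]mulrC.
have cos_cont := continuous_translate (b := c) (@continuous_cos R).
have sin_cont := continuous_translate (b := c) (@continuous_sin R).
rewrite !circle_meanD.
- by rewrite !circle_meanZ// circle_mean_cst circle_mean_cos circle_mean_sin !mulr0 !addr0.
- by move=> a; exact: cvg_cst.
- exact: continuous_mulcst.
- by apply: continuous_sum2; [move=> a; exact: cvg_cst|exact: continuous_mulcst].
- exact: continuous_mulcst.
Qed.

Lemma gyrate_e3 b : gyrate wc b (delta_mx ord_max 0 : vec, 0 : vec) =
  (delta_mx ord_max 0, 0).
Proof.
by congr pair; apply: vec_ext; rewrite /= !(rotation_coord, curlE_coord, mxE)/=; ring.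
Qed.

Lemma average_oppr (g : vec -> R) (x v : vec) : continuous g ->
  average wc (fun y _ => - g y) x v = - average wc (fun y _ => g y) x v.
Proof.
move=> g_cont; have [c avgE] := average_circle_mean wc x v; rewrite !avgE.
under [X in circle_mean X]eq_fun do rewrite -mulN1r.
rewrite circle_meanZ ?mulN1r//.
apply: (continuous_translate (h := fun a => g (gyrate wc a (x, v)).1)).
exact: continuous_along_orbit.
Qed.

(** The function d stands for the time derivative of f, constant along the orbit
    because f is so at each time. *)
Lemma average_field_terms (r : R) (phi : vec -> R) (d : vec -> vec -> R) (x v : vec) :
  (forall y, differentiable phi y) ->
  (forall i, continuous (fun y => electric_field phi y i 0)) ->
  (forall b, d (gyrate wc b (x, v)).1 (gyrate wc b (x, v)).2 = d x v) ->
  let meanE i := average wc (fun y _ => electric_field phi y i 0) x v in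
  average wc (fun y w => d y w + third w * third (grad_x u y w)
                + r * dot (electric_field phi y) (grad_v u y w)) x v
  = d x v + third v * third (grad_x u x v)
    + r * (wc^-1 * (meanE 1 * grad_x u x v 0 0 - meanE 0 * grad_x u x v 1 0)
           + meanE ord_max * grad_v u x v ord_max 0).
Proof.
move=> dphi E_cont d_inv meanE; rewrite /meanE {meanE}.
have [c avgE] := average_circle_mean wc x v; rewrite !{}avgE.
have [l DvE] := derive_v_gyrate wc_neq0 x v dU TU0.
have work0 := circle_mean_potential_work wc_neq0 x v c dphi E_cont.
pose Ea i a := electric_field phi (gyrate wc (a - c) (x, v)).1 i 0.
pose work a := rotation (a - c) v 0 0 * Ea 0 a + rotation (a - c) v 1 0 * Ea 1 a.
have Ea_cont i : continuous (Ea i).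
  apply: (continuous_translate (h := fun a => electric_field phi (gyrate wc a (x, v)).1 i 0)).
  exact: (continuous_along_orbit (g := fun y => electric_field phi y i 0)).
have work_cont : continuous work.
  have rot_cont i : continuous (fun a : R => rotation (a - c) v i 0).
    by apply: (continuous_translate (h := fun a => rotation a v i 0)); exact: continuous_rotation.
  move=> a; rewrite /work; apply: cvgD; apply: cvgM;
    [exact: rot_cont|exact: Ea_cont|exact: rot_cont|exact: Ea_cont].
set gx := grad_x u x v; set gv := grad_v u x v.
pose K := d x v + third v * third gx.
have integrandE a : let p := gyrate wc (a - c) (x, v) in
    d p.1 p.2 + third p.2 * third (grad_x u p.1 p.2)
      + r * dot (electric_field phi p.1) (grad_v u p.1 p.2) =
    K + (r * wc^-1 * gx 0 0 * Ea 1 a + (- (r * wc^-1 * gx 1 0) * Ea 0 a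
      + (r * gv ord_max 0 * Ea ord_max a + r * l * work a))).
  move=> p.
  have -> : third p.2 = third v by rewrite /third rotation_coord.
  have -> : third (grad_x u p.1 p.2) = third gx.
    rewrite /third /gx /grad_x !mxE !derive_sliceL -surjective_pairing.
    by rewrite (derive_gyrate dU wc_neq0 TU0) gyrate_e3.
  have -> : dot (electric_field phi p.1) (grad_v u p.1 p.2) =
      'D_(0, electric_field phi p.1) U p.
    rewrite [in RHS](surjective_pairing p) derive_phase//.
    by rewrite [X in X + _](_ : _ = 0) ?add0r// dot3 !mxE; ring.
  rewrite DvE d_inv -/gx -/gv -/K -!/(Ea _ a) -/(work a).
  by move: (Ea 0 a) (Ea 1 a) (Ea ord_max a) (work a) => e0 e1 e2 w; ring.
under [X in circle_mean X]eq_fun do rewrite integrandE.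
have cst_cont (k : R) : continuous (fun _ : R => k) by move=> a; exact: cvg_cst.
have Es_cont i k : continuous (fun a => k * Ea i a) by exact: continuous_mulcst.
have ws_cont k : continuous (fun a => k * work a) by exact: continuous_mulcst.
have E2w_cont : continuous (fun a => r * gv ord_max 0 * Ea ord_max a + r * l * work a).
  exact: continuous_sum2.
have E0_cont : continuous (fun a => - (r * wc^-1 * gx 1 0) * Ea 0 a
    + (r * gv ord_max 0 * Ea ord_max a + r * l * work a)) by exact: continuous_sum2.
have E1_cont : continuous (fun a => r * wc^-1 * gx 0 0 * Ea 1 a
    + (- (r * wc^-1 * gx 1 0) * Ea 0 a
    + (r * gv ord_max 0 * Ea ord_max a + r * l * work a))) by exact: continuous_sum2.
rewrite (circle_meanD (cst_cont K) E1_cont) (circle_meanD (Es_cont _ _) E0_cont).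
rewrite (circle_meanD (Es_cont _ _) E2w_cont) (circle_meanD (Es_cont _ _) (ws_cont _)).
rewrite !circle_meanZ// !circle_mean_cst (_ : circle_mean work = 0)// /K.
rewrite -!/(Ea _).
move: (circle_mean (Ea 0)) (circle_mean (Ea 1)) (circle_mean (Ea ord_max)) => e0 e1 e2.
by ring.
Qed.

End AverageAlongOrbits.

(** * Time slices and the limit model *)

Section TimeSlices.
Variable R : realType.
Local Notation vec := ('cV[R]_3).
Local Notation phase := (vec * vec)%type.

(** The image filters coincide, hence so do their limits, existing or not. *)
Lemma eq_in_lim_within (T : Type) (V : ptopologicalType) (A : set T)
    (F : set_system T) (g h : T -> V) :
  (forall s, A s -> g s = h s) -> lim (g @ within A F) = lim (h @ within A F).
Proof.
move=> gh; congr (lim _); apply/funext => P; apply/propext.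
change (F (fun s => A s -> P (g s)) <-> F (fun s => A s -> P (h s))).
suff -> : (fun s => A s -> P (g s)) = (fun s => A s -> P (h s)) by [].
by apply/funext => s; apply/propext; split=> AP As; [rewrite -gh//|rewrite gh//]; exact: AP.
Qed.

Lemma dt_eq (f : R -> vec -> vec -> R) (t : R) (x v y w : vec) : 0 <= t ->
  (forall s, 0 <= s -> f s x v = f s y w) -> dt f t x v = dt f t y w.
Proof.
move=> t_ge0 f_eq; apply: eq_in_lim_within => h /= th_ge0.
by rewrite !f_eq.
Qed.

Variables (F : R * vec * vec -> R) (t : R).
Let Ft (p : phase) : R := F (t, p.1, p.2).

Lemma derive_time_slice p q : 'D_q Ft p = 'D_(0, q.1, q.2) F (t, p.1, p.2).
Proof.
have slice_line h : (t, h *: q.1 + p.1, h *: q.2 + p.2) =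
    h *: (0, q.1, q.2) + (t, p.1, p.2) :> R * vec * vec.
  by congr (_, _, _); rewrite /= scaler0 add0r.
by rewrite /derive; under [in RHS]eq_fun do rewrite /= -slice_line.
Qed.

Lemma differentiable_time_slice p :
  differentiable F (t, p.1, p.2) -> differentiable Ft p.
Proof.
move=> dF.
have dfst : differentiable (fst : phase -> vec) p.
  by apply: linear_differentiable => ?; exact: cvg_fst.
have dsnd : differentiable (snd : phase -> vec) p.
  by apply: linear_differentiable => ?; exact: cvg_snd.
apply: (@differentiable_comp _ _ _ _ (fun p : phase => (t, p.1, p.2)) F) => //.
by apply: differentiable_pair => //; exact: differentiable_pair.
Qed.

End TimeSlices.

Theorem theorem1p2 (R : realType) (m q B tau theta : R)
    (m_gt0 : 0 < m) (q_neq0 : q != 0) (B_gt0 : 0 < B)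
    (tau_gt0 : 0 < tau) (theta_gt0 : 0 < theta)
    (phi : 'cV[R]_3 -> R) (phi_smooth : smooth phi)
    (fin : 'cV[R]_3 -> 'cV[R]_3 -> R)
    (f : R -> 'cV[R]_3 -> 'cV[R]_3 -> R) (f_smooth : smooth_in_time f) :
  let wc := q * B / m in
  let E := electric_field phi in
  limit_model m q wc E (Q_FP m tau theta) fin f ->
  (forall (t : R) (x v : 'cV[R]_3), 0 <= t ->
     dt f t x v
     + dot (B^-1 *: average_vec wc (fun y _ => perp (bar (E y))) x v)
           (bar (grad_x (f t) x v))
     + third v * third (grad_x (f t) x v)
     + q / m * average wc (fun y _ => third (E y)) x v
       * third (grad_v (f t) x v)
     = averaged_Q_FP m tau theta wc (f t) x v)
  /\ (forall x v, f 0 x v = average wc fin x v).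
Proof.
move=> wc E [T0 limit_eq f0]; split=> // t x v t_ge0.
have wc_neq0 : wc != 0 by rewrite !mulf_neq0 ?invr_neq0// gt_eqF.
have [F [F_smooth FE]] := f_smooth.
pose U s (p : 'cV[R]_3 * 'cV[R]_3) := F (s, p.1, p.2).
have fE s : 0 <= s -> f s = (fun x v => U s (x, v)).
  by move=> s_ge0; apply/funext => y; apply/funext => w; exact: FE.
have dU s p : differentiable (U s) p.
  exact/differentiable_time_slice/(F_smooth 1).1.
have d2U p r : differentiable ('D_r (U t)) p.
  rewrite (_ : 'D_r (U t) = fun p => 'D_(0, r.1, r.2) F (t, p.1, p.2)).
    apply: (@differentiable_time_slice _ ('D_(0, r.1, r.2) F) t p).
    exact: ((F_smooth 2).2 _).1.
  by apply/funext => p'; exact: derive_time_slice.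
have TU0 s : 0 <= s -> forall y w, transport wc (fun x v => U s (x, v)) y w = 0.
  by move=> s_ge0 y w; rewrite -fE//; exact: T0.
have f_inv b s : 0 <= s ->
    f s (gyrate wc b (x, v)).1 (gyrate wc b (x, v)).2 = f s x v.
  move=> s_ge0; rewrite fE// -surjective_pairing.
  exact: (transport0_invariant (dU s) wc_neq0 (TU0 s s_ge0)).
have dt_inv b : dt f t (gyrate wc b (x, v)).1 (gyrate wc b (x, v)).2 = dt f t x v.
  by apply: dt_eq => // s; exact: f_inv.
have dphi y : differentiable phi y := (phi_smooth 1).1 y.
have E_cont i : continuous (fun y => E y i 0).
  have EE : (fun y => E y i 0) = - 'D_(delta_mx i 0) phi.
    by apply/funext => y; rewrite /E /electric_field !mxE.
  have D_cont : continuous ('D_(delta_mx i 0) phi) := (phi_smooth 1).2 _.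
  by rewrite EE => y; exact: continuousN (D_cont y).
have := limit_eq t x v t_ge0; rewrite fE//.
rewrite (average_Q_FP wc_neq0 (dU t) (TU0 t t_ge0) tau x v m_gt0 theta_gt0 d2U) => <-.
rewrite (average_field_terms wc_neq0 (dU t) (TU0 t t_ge0) (q / m) dphi E_cont dt_inv).
have perp0 : average_vec wc (fun y _ => perp (bar (E y))) x v 0 0 =
    average wc (fun y _ => E y 1 0) x v.
  rewrite mxE; congr (average _ _ _ _); apply/funext => y; apply/funext => w.
  by rewrite perp_coord bar_coord.
have perp1 : average_vec wc (fun y _ => perp (bar (E y))) x v 1 0 =
    - average wc (fun y _ => E y 0 0) x v.
  rewrite mxE -(average_oppr wc x v (g := fun y => E y 0 0) (E_cont 0)); congr (average _ _ _ _).
  by apply/funext => y; apply/funext => w; rewrite perp_coord bar_coord.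
have scale_coord k (w : 'cV[R]_2) j : (k *: w) j 0 = k * w j 0 by rewrite mxE.
rewrite dot2 !bar_coord !scale_coord perp0 perp1 /third -/E.
move: (average _ _ _ _) (average _ _ _ _) (average _ _ _ _) => e1 e0 e2.
move: (grad_x _ _ _) (grad_v _ _ _) => gx gv.
by rewrite /wc; field; rewrite q_neq0 !gt_eqF.
Qed.
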